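(* Let $\ell \neq f$ be primes, let $\mathbf{F}_q$ be a finite field with $q \equiv 1 \pmod{\ell f}$, let $g$ be a generator of $\mathbf{F}_q^\times$, let $L = \mathbf{Q}(\zeta_{\ell f})$ with $\zeta_{\ell f}$ a primitive $\ell f$-th root of unity in $\overline{\mathbf{Q}}$, let $\mathcal{O}_L = \mathbf{Z}[\zeta_{\ell f}]$, and let $\pi_\ell = \zeta_{\ell f}^{f} - 1 \in \mathcal{O}_L$. Let $\chi : \mathbf{F}_q^\times \to L^\times$ be a character of order $\ell f$ and let $J(\ell, f) = \sum_{x \in \mathbf{F}_q \setminus \{0,1\}} \chi^{\ell}(x)\chi^{f}(1-x) \in \mathcal{O}_L$. Let $\eta_{i,j} \in \mathbf{F}_q^\times$ be the elements defined in the context. Then for every $k \in [1, \ell - 1]$, the following are equivalent: (1) $J(\ell, f) + 1 \in \pi_\ell^k \mathcal{O}_L$; (2) $\eta_{i,j} \in \mathbf{F}_q^{\times \ell}$ for all $i \in [0, k-2]$ and $j \in [1, f-1]$; (3) $\eta_{i,j} \in \mathbf{F}_q^{\times \ell}$ for all $i \in [0, k-2]$ and $j \in [1, f/2]$. In particular, $J(\ell, f) + 1 \in \pi_\ell \mathcal{O}_L$ always holds.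
   Context: Intervals $[a,b]$ denote the set of integers $n$ with $a \le n \le b$ (empty if $b < a$). $\mathbf{F}_q^{\times \ell}$ denotes the subgroup of $\ell$-th powers in $\mathbf{F}_q^\times$. In $\mathbf{F}_q^\times$, put $\bar\zeta_{\ell f} = g^{(q-1)/(\ell f)}$ (a primitive $\ell f$-th root of unity in $\mathbf{F}_q$); let $\xi_\ell \in \mathbf{F}_q^\times$ be the unique $\ell$-th root of unity with $\xi_\ell^{f} = \bar\zeta_{\ell f}^{\,f}$, and let $\xi_f \in \mathbf{F}_q^\times$ be the unique $f$-th root of unity with $\xi_f^{\ell} = \bar\zeta_{\ell f}^{\,\ell}$. For $i \in [0, \ell-1]$ and $j \in [1, f-1]$, define $\eta_{i,j} = \prod_{r=0}^{\ell-1} \left(1 - \xi_\ell^{r}\xi_f^{j}\right)^{\binom{r}{i}} \in \mathbf{F}_q^\times$. *)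

(* Defs.v *)
From HB Require Import structures.
From mathcomp Require Import all_boot all_order all_algebra all_fingroup.
From mathcomp Require Import all_solvable all_field all_character.

Set Implicit Arguments.
Unset Strict Implicit.
Unset Printing Implicit Defensive.

Import Order.TTheory GRing.Theory Num.Theory.

Local Open Scope ring_scope.

(* The number field Q(z) and the ring Z[z] are taken inside algC.  Since algC  *)
(* consists of algebraic numbers, every element of Q(z) is a polynomial in z.  *)
Definition Qadjoin (z x : algC) : Prop :=
  exists p : {poly rat}, x = (map_poly ratr p).[z].

Definition Zadjoin (z x : algC) : Prop :=
  exists p : {poly int}, x = (map_poly intr p).[z].

(* x \in a Z[z] *)
Definition in_Zadjoin_ideal (z a x : algC) : Prop :=
  exists2 y : algC, Zadjoin z y & x = a * y.

Section FiniteField.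

Variable F : finFieldType.

(* The class function chi on the unit group, evaluated at an element of F;     *)
(* the value at 0 is a dummy one and is never used.                            *)
Definition cfun_at (chi : 'CF([set: {unit F}])) (x : F) : algC :=
  chi (insubd (1%g : {unit F}) x).

Definition jacobi_sum (chi psi : 'CF([set: {unit F}])) : algC :=
  \sum_(x : F | (x != 0) && (x != 1)) cfun_at chi x * cfun_at psi (1 - x).

Definition root_of_generator (g : {unit F}) (n : nat) : F :=
  val g ^+ (#|F|.-1 %/ n).

Definition eta_prod (l : nat) (xil xif : F) (i j : nat) : F :=
  \prod_(0 <= r < l) (1 - xil ^+ r * xif ^+ j) ^+ 'C(r, i).

(* x lies in the subgroup of l-th powers of the unit group; in particular      *)
(* x != 0.                                                                     *)
Definition unit_power (l : nat) (x : F) : Prop :=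
  exists u : {unit F}, x = val u ^+ l.

End FiniteField.

(* Main.v *)
Require Import Defs.
From HB Require Import structures.
From mathcomp Require Import all_boot all_order all_algebra all_fingroup.
From mathcomp Require Import all_solvable all_field all_character.
From mathcomp Require Import ring zify.

Set Implicit Arguments.
Unset Strict Implicit.
Unset Printing Implicit Defensive.

Import Order.TTheory GRing.Theory Num.Theory.

Local Open Scope ring_scope.

(* Write [log] for the discrete logarithm to base g.  In a ring R of            *)
(* characteristic l containing a suitable f-th root of unity th, put            *)
(*   U_m = \sum_x th^(log x) C(log (1 - x), m),                                 *)
(*   V_i = \sum_y (th^(log y) - 1) C(log y, i) log (1 - y).                     *)
(* Expanding chi^f(1 - x) = (1 + p)^(log (1 - x)) with p = chi(g)^f - 1, an     *)
(* associate of pil, U_m is the coefficient of p^m in J(l, f), reduced mod l.   *)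
(* Summing th^(log x) C(log y, m) log z over x + y + z = 1 in two ways, which   *)
(* is the derivative of the cocycle relation of Jacobi sums, gives              *)
(*   (m + 1) U_(m+1) + m U_m = - \sum_(i <= m) U_(m - i) V_i,   U_0 = -1,       *)
(* so that U_1, ..., U_(k-1) vanish iff V_0, ..., V_(k-2) do.  Finally the      *)
(* product of 1 - y over a coset of the (l f)-th powers is 1 - xil^r xif^j for  *)
(* some r and j, so the coefficient of th^j in V_i is log (eta_(i,j)) mod l.    *)

(** Put om = chi(g)^f, th = chi(g)^l and p = om - 1. [jacobi_sum_expansion] writes J(l, f) + 1 as
    \sum_(m >= 1) p^m u_m with u_m in Z[th]. Since p^(l - 1) divides l and l is unramified in Z[th],
    p divides u_m only if l does. Comparing terms one power of p at a time, for k <= l - 1, shows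
    that p^k divides J(l, f) + 1 iff l divides u_1, ..., u_(k-1) ([jacobi_sum_ideal]).

    Divisibility of u_m by l is the vanishing of U_m in F_l[X] / (1 + ... + X^(f - 1)), where the
    recurrence above applies ([jacobi_coef_rec], [jacobi_coef_vanish]). There V_i = \sum_a L_a (th^a
    - 1), with L_j = log (eta_(i,j)) for 0 < j < f. The th^a - 1 with 0 < a < f are independent
    because f is invertible mod l, so V_i = 0 iff all eta_(i,j) are l-th powers
    ([jacobi_class_coef_eta]).

    Half of the indices j suffice: inverting the roots of unity expresses log (eta_(i,f-j)) through
    the log (eta_(a,j)) with a <= i ([eta_prod_reflect]). For k = 1 no condition is left. *)

(** * Binomial coefficients modulo a prime *)

(** Multiplication by n in the binomial basis: weighting by a logarithm raises the index m, which is
    the source of the left side of the recurrence. *)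
Lemma muln_bin n m : ('C(n, m) * n = m.+1 * 'C(n, m.+1) + m * 'C(n, m))%N.
Proof.
rewrite mul_bin_left -mulnDl.
by have [le_mn | lt_nm] := leqP m n; [rewrite subnK // mulnC | rewrite bin_small // muln0].
Qed.

Lemma sum_bin_upper N m : (\sum_(0 <= n < N) 'C(n, m) = 'C(N, m.+1))%N.
Proof.
elim: N => [|N IHN]; first by rewrite big_geq.
by rewrite big_nat_recr //= IHN binS.
Qed.

Section BinomialModPrime.

Variables (l : nat) (R : comNzRingType).
Hypothesis charR : l \in [pchar R].

Let l_pr : prime l. Proof. exact: pcharf_prime charR. Qed.

Lemma natr_eq_modn a b : a = b %[mod l] -> a%:R = b%:R :> R.
Proof. move=> eq_ab; rewrite (divn_eq a l) (divn_eq b l) eq_ab !natrD !natrM.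
by rewrite (pcharf0 charR) !mulr0. Qed.

(** In Vandermonde's formula for C(c + l, m) all C(l, m - i) with 0 < m - i < l vanish mod l. Hence
    C(log x, m) only depends on log x mod l. *)
Lemma natr_bin_eq_modn m a b : (m < l)%N -> a = b %[mod l] ->
  'C(a, m)%:R = 'C(b, m)%:R :> R.
Proof.
move=> lt_ml.
have shift c : 'C(c + l, m)%:R = 'C(c, m)%:R :> R.
  rewrite -binomial.Vandermonde natr_sum big_ord_recr /= subnn bin0 muln1 big1 ?add0r //.
  move=> i _; rewrite natrM; have -> : 'C(l, m - i)%:R = 0 :> R.
    apply/eqP; rewrite -(dvdn_pcharf charR) prime_dvd_bin //.
    by have := ltn_ord i; lia.
  by rewrite mulr0.
have red c : 'C(c, m)%:R = 'C(c %% l, m)%:R :> R.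
  rewrite {1}(divn_eq c l); elim: (c %/ l)%N => [|n IHn]; first by [].
  by rewrite -IHn -[RHS]shift mulSn -addnA addnC.
by move=> eq_ab; rewrite red eq_ab -red.
Qed.

(** R may have zero divisors, so m is cancelled through its Bezout inverse mod l. *)
Lemma coprime_natr_mulf_eq0 m (x : R) : coprime m l -> m%:R * x = 0 -> x = 0.
Proof.
move=> co_ml mx0; have [m0 | m_gt0] := posnP m.
  by move: co_ml; rewrite m0 /coprime gcd0n eq_sym ltn_eqF // prime_gt1.
have [u v Duv _] := egcdnP l m_gt0.
have: (u * m)%:R * x = 0 by rewrite natrM -mulrA mx0 mulr0.
by rewrite Duv (eqP co_ml) natrD natrM (pcharf0 charR) mulr0 add0r mul1r.
Qed.

Lemma natr_mulf_eq0 m (x : R) : (0 < m < l)%N -> m%:R * x = 0 -> x = 0.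
Proof.
move=> /andP[m_gt0 lt_ml]; apply: coprime_natr_mulf_eq0.
by rewrite coprime_sym prime_coprime // gtnNdvd.
Qed.

Lemma sum_bin_eq0 N m : (m.+1 < l)%N -> (l %| N)%N ->
  \sum_(0 <= n < N) 'C(n, m)%:R = 0 :> R.
Proof.
move=> lt_ml l_dv_N; rewrite -natr_sum sum_bin_upper.
by rewrite (@natr_bin_eq_modn _ _ 0) ?bin0n // mod0n; apply/eqP.
Qed.

Lemma sum_natr_mul_bin_eq0 N m : (m.+2 < l)%N -> (l %| N)%N ->
  \sum_(0 <= n < N) 'C(n, m)%:R * n%:R = 0 :> R.
Proof.
move=> lt_ml l_dv_N.
under eq_bigr => n _ do rewrite -natrM muln_bin natrD !natrM.
by rewrite big_split /= -!mulr_sumr !sum_bin_eq0 ?mulr0 ?addr0 // ltnW.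
Qed.

End BinomialModPrime.

(** * Discrete logarithms *)

(** The list does not contain 0, whose logarithm is the dummy value [#|F|.-1]. *)
Definition dlog (F : finFieldType) (g : {unit F}) (x : F) : nat :=
  index x [seq val g ^+ n | n <- iota 0 #|F|.-1].

Section DiscreteLogarithm.

Variables (F : finFieldType) (g : {unit F}).
Hypothesis g_gen : generator [set: {unit F}] g.

Local Notation N := #|F|.-1.
Local Notation log := (dlog g).

Lemma order_unit_generator : #[g]%g = N.
Proof. by rewrite orderE -(eqP g_gen) card_finField_unit. Qed.

Lemma unit_generator_neq0 : val g != 0.
Proof. by rewrite -unitfE (valP g). Qed.

Lemma unit_generator_exp_neq0 n : val g ^+ n != 0.
Proof. by rewrite expf_neq0 ?unit_generator_neq0. Qed.

Lemma eq_exp_generator m n :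
  (val g ^+ m == val g ^+ n) = (m == n %[mod N]).
Proof. by rewrite -!FinRing.val_unitX (inj_eq val_inj) eq_expg_mod_order order_unit_generator. Qed.

Lemma prim_root_generator : N.-primitive_root (val g).
Proof.
rewrite /primitive_root_of_unity -{1}order_unit_generator order_gt0.
apply/forallP=> i; rewrite unity_rootE -(expr0 (val g)) eq_exp_generator mod0n.
apply/eqP; apply/eqP/eqP=> [/eqP i_N | ->]; last exact: modnn.
by have := dvdn_leq (ltn0Sn i) i_N; have := ltn_ord i; lia.
Qed.

Lemma ltn_dlog x : x != 0 -> (log x < N)%N.
Proof.
move=> x_neq0; rewrite -[N in (_ < N)%N](size_iota 0).
rewrite -(size_map (fun n => val g ^+ n)) index_mem; apply/mapP.
have Ux : x \is a GRing.unit by rewrite unitfE.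
have /cycleP[n Dx] : FinRing.Unit Ux \in <[g]>%g by rewrite -(eqP g_gen) inE.
exists (n %% N)%N; first by rewrite mem_iota ltn_mod -order_unit_generator order_gt0.
transitivity (val g ^+ n); first by rewrite -FinRing.val_unitX -Dx.
by apply/eqP; rewrite eq_exp_generator modn_mod.
Qed.

Lemma dlogK x : x != 0 -> val g ^+ log x = x.
Proof.
move=> x_neq0; have lt_logN := ltn_dlog x_neq0.
have x_in : x \in [seq val g ^+ n | n <- iota 0 N].
  by rewrite -index_mem size_map size_iota.
by rewrite -[RHS](nth_index 0 x_in) (nth_map 0%N) ?nth_iota ?size_iota.
Qed.

Lemma dlogX n : log (val g ^+ n) = n %[mod N].
Proof. by apply/eqP; rewrite -eq_exp_generator dlogK ?unit_generator_exp_neq0. Qed.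

Lemma dlog1 : log 1 = 0%N.
Proof.
rewrite /dlog; have: (0 < N)%N by rewrite -order_unit_generator order_gt0.
by case: N => // n _; rewrite /= expr0 eqxx.
Qed.

Lemma dlogM x y : x != 0 -> y != 0 -> log (x * y) = (log x + log y)%N %[mod N].
Proof.
move=> x0 y0; apply/eqP; rewrite -eq_exp_generator exprD !dlogK //.
by rewrite mulf_neq0.
Qed.

Lemma sum_dlog (R : nmodType) (P : pred F) (G : F -> R) :
  \sum_(x : F | (x != 0) && P x) G x =
  \sum_(0 <= n < N | P (val g ^+ n)) G (val g ^+ n).
Proof.
rewrite -(big_map (fun n => val g ^+ n) P G) big_mkcondr -big_filter.
rewrite [RHS]big_mkcond; apply: perm_big; apply: uniq_perm.
- by rewrite filter_uniq ?index_enum_uniq.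
- rewrite map_inj_in_uniq ?iota_uniq // => m n.
  rewrite !mem_index_iota /= => lt_mN lt_nN /eqP.
  by rewrite eq_exp_generator !modn_small // => /eqP.
move=> x; rewrite mem_filter mem_index_enum andbT.
apply/idP/mapP=> [x0 | [n _ ->]]; last exact: unit_generator_exp_neq0.
exists (log x %% N)%N; first by rewrite mem_index_iota ltn_mod -order_unit_generator order_gt0.
by rewrite -{1}(dlogK x0); apply/eqP; rewrite eq_exp_generator modn_mod.
Qed.

Lemma dlog_exp n : (n < N)%N -> log (val g ^+ n) = n.
Proof.
move=> lt_nN; rewrite -[RHS](modn_small lt_nN) -dlogX modn_small //.
exact/ltn_dlog/unit_generator_exp_neq0.
Qed.

Lemma sum_dlog_nat (R : nmodType) (P : pred nat) (G : nat -> R) :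
  \sum_(x : F | (x != 0) && P (log x)) G (log x) = \sum_(0 <= n < N | P n) G n.
Proof.
rewrite (sum_dlog (P \o log) (G \o log)) /= big_nat_cond [RHS]big_nat_cond.
apply: eq_big => [n | n /andP[/andP[_ lt_nN] _]]; last by rewrite dlog_exp.
by have [/andP[_ lt_nN] | //] := boolP (0 <= n < N)%N; rewrite dlog_exp.
Qed.

End DiscreteLogarithm.

(** * The cocycle relation of Jacobi sums modulo l *)

Section JacobiCocycle.

Variables (l : nat) (R : comNzRingType).
Hypothesis charR : l \in [pchar R].
Variables (F : finFieldType) (g : {unit F}).
Hypothesis g_gen : generator [set: {unit F}] g.

Local Notation N := #|F|.-1.
Local Notation log := (dlog g).

Hypothesis l_dvd_N : (l %| N)%N.

Variable theta : R.
Hypothesis theta_N : theta ^+ N = 1.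
Hypothesis theta_sum : \sum_(0 <= n < N) theta ^+ n = 0.

Let ch x := theta ^+ log x.
Let C m x : R := 'C(log x, m)%:R.
Let La x : R := (log x)%:R.

Let eqN_eql a b : a = b %[mod N] -> a = b %[mod l].
Proof. by move=> eq_ab; rewrite -(modn_dvdm a l_dvd_N) eq_ab modn_dvdm. Qed.

Lemma exp_dlogM x y : x != 0 -> y != 0 -> ch (x * y) = ch x * ch y.
Proof.
move=> x0 y0; rewrite /ch -exprD -(expr_mod (log (x * y)) theta_N).
by rewrite (dlogM g_gen x0 y0) expr_mod.
Qed.

Lemma natr_dlogM x y : x != 0 -> y != 0 -> La (x * y) = La x + La y.
Proof.
by move=> x0 y0; rewrite /La -natrD; apply/(natr_eq_modn charR)/eqN_eql/dlogM.
Qed.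

Lemma natr_bin_dlogM m x y : (m < l)%N -> x != 0 -> y != 0 ->
  C m (x * y) = \sum_(i < m.+1) C i x * C (m - i) y.
Proof.
move=> lt_ml x0 y0.
rewrite /C (natr_bin_eq_modn charR lt_ml (eqN_eql (dlogM g_gen x0 y0))).
by rewrite -binomial.Vandermonde natr_sum; apply: eq_bigr => i _; rewrite natrM.
Qed.

Let C0 x : C 0 x = 1. Proof. by rewrite /C bin0. Qed.

Let C_La m x : C m x * La x = m.+1%:R * C m.+1 x + m%:R * C m x.
Proof. by rewrite /C /La -!natrM -natrD muln_bin. Qed.


Let U m := \sum_(x | (x != 0) && (x != 1)) ch x * C m (1 - x).
(** [M1 i - M0 i] is the V_i of the introduction; each half arises from one of the two evaluations
    of [T] below. *)
Let M1 i := \sum_(y | (y != 0) && (y != 1)) ch y * C i y * La (1 - y).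
Let M0 i := \sum_(y | (y != 0) && (y != 1)) C i y * La (1 - y).

Let sum_neq0 (G : nat -> R) : \sum_(x | x != 0) G (log x) = \sum_(0 <= n < N) G n.
Proof. by rewrite -(sum_dlog_nat g_gen predT); apply: eq_bigl => x; rewrite andbT. Qed.

Let sum_C i : (i.+1 < l)%N ->
  \sum_(y | (y != 0) && (y != 1)) C i y = - (i == 0%N)%:R.
Proof.
move=> lt_il; have /eqP := sum_bin_eq0 charR lt_il l_dvd_N.
rewrite -(sum_neq0 (fun n => 'C(n, i)%:R)) (bigD1 1) ?oner_eq0 //= addrC addr_eq0.
by move/eqP->; rewrite (dlog1 g_gen) bin0n.
Qed.

(** The sum of [ch] over all nonzero x vanishes, and the excluded x = 1 contributes 1. *)
Lemma jacobi_coef0 : U 0 = -1.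
Proof.
have /eqP := theta_sum; rewrite -(sum_neq0 (fun n => theta ^+ n)).
rewrite (bigD1 1) ?oner_eq0 //= addrC addr_eq0 (dlog1 g_gen) expr0 => /eqP <-.
by apply: eq_bigr => x _; rewrite C0 mulr1.
Qed.

(** This disposes of the part x = 1 of [T], where z = - y. *)
Let sum_C_LaN m : (m.+2 < l)%N -> \sum_(y | y != 0) C m y * La (- y) = 0.
Proof.
move=> lt_ml.
transitivity (\sum_(y | y != 0) (C m y * La (-1) + C m y * La y)).
  apply: eq_bigr => y y0; rewrite -mulrDr -natr_dlogM ?mulN1r //.
  by rewrite oppr_eq0 oner_eq0.
rewrite big_split /= -mulr_suml (sum_neq0 (fun n => 'C(n, m)%:R)).
rewrite (sum_neq0 (fun n => 'C(n, m)%:R * n%:R)).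
by rewrite (sum_bin_eq0 charR) ?(sum_natr_mul_bin_eq0 charR) // ?mul0r ?addr0 // ltnW.
Qed.

(* Both sides evaluate T, the sum over x + y + z = 1 with x, y, z != 0: T1      *)
(* fixes w = x + y = 1 - z (where w = 0 contributes log 1 = 0), T0 fixes x.     *)
Lemma jacobi_coef_rec m : (m.+2 < l)%N ->
  m.+1%:R * U m.+1 + m%:R * U m = \sum_(i < m.+1) U (m - i) * (M0 i - M1 i).
Proof.
move=> lt_ml; have lt_m1l := ltnW lt_ml; have lt_m0l := ltnW lt_m1l.
pose T := \sum_(x : F | x != 0) \sum_(w | (w != x) && (w != 1))
            ch x * C m (w - x) * La (1 - w).
(* Replacing x by w x turns the arguments into w x and w (1 - x), so that [ch] and, by Vandermonde,
   [C m] split into a factor in w and a factor in x. *)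
have T1 : T = \sum_(i < m.+1) U (m - i) * M1 i.
  have -> : T = \sum_(w | (w != 0) && (w != 1)) \sum_(x | (x != 0) && (x != 1))
       ch (w * x) * C m (w * (1 - x)) * La (1 - w).
    rewrite /T (exchange_big_dep [pred w : F | w != 1]) /=; last by move=> x w _ /andP[].
    rewrite (bigD1 0) /= ?(eq_sym 0) ?oner_eq0 // big1 ?add0r; last first.
      by move=> x _; rewrite subr0 /La (dlog1 g_gen) mulr0.
    apply: eq_big => [w | w /andP[w1 w0]]; first exact: andbC.
    rewrite (reindex_inj (mulfI w0)) /=; apply: eq_big => [x | x _].
      rewrite mulf_eq0 (negPf w0) w1 andbT /= -[X in X != _ * _]mulr1.
      by rewrite (inj_eq (mulfI w0)) (eq_sym 1).
    by rewrite mulrBr mulr1.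
  transitivity (\sum_(w | (w != 0) && (w != 1)) \sum_(i < m.+1)
                  U (m - i) * (ch w * C i w * La (1 - w))).
    apply: eq_bigr => w /andP[w0 w1]; under [RHS]eq_bigr => i _ do rewrite /U mulr_suml.
    rewrite exchange_big /=; apply: eq_bigr => x /andP[x0 x1].
    have x10 : 1 - x != 0 by rewrite subr_eq0 eq_sym.
    rewrite exp_dlogM // natr_bin_dlogM // mulr_sumr mulr_suml.
    by apply: eq_bigr => i _; ring.
  by rewrite exchange_big /=; apply: eq_bigr => i _; rewrite -mulr_sumr.
(* For x != 1, the substitution w = x + (1 - x) y gives w - x = y (1 - x) and 1 - w = (1 - x) (1 -
   y). *)
have T0 : T = \sum_(i < m.+1) U (m - i) * M0 i - (m.+1%:R * U m.+1 + m%:R * U m).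
  have -> : T = \sum_(x | (x != 0) && (x != 1)) \sum_(y | (y != 0) && (y != 1))
       ch x * C m (y * (1 - x)) * La ((1 - x) * (1 - y)).
    rewrite /T (bigD1 1) ?oner_eq0 //= [X in X + _](_ : _ = 0) ?add0r.
      apply: eq_bigr => x /andP[x0 x1].
      have x10 : 1 - x != 0 by rewrite subr_eq0 eq_sym.
      have inj_h : injective (fun y => x + (1 - x) * y).
        by move=> y z /addrI /(mulfI x10).
      rewrite (reindex_inj inj_h) /=; apply: eq_big => [y | y _].
        rewrite -subr_eq0 addrAC subrr add0r mulf_eq0 (negPf x10) /=.
        have -> : (x + (1 - x) * y == 1) = ((1 - x) * (y - 1) == 0).
          by rewrite -subr_eq0; congr (_ == 0); ring.
        by rewrite mulf_eq0 (negPf x10) subr_eq0.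
      by congr (_ * C m _ * La _); ring.
    rewrite -[RHS](sum_C_LaN lt_ml).
    have inj_h : injective (fun y : F => y + 1) by move=> y z /addIr.
    rewrite (reindex_inj inj_h) /=; apply: eq_big => [y | y _].
      by rewrite andbb -subr_eq0 addrK.
    by rewrite /ch (dlog1 g_gen) mul1r; congr (C m _ * La _); ring.
  (* The summand log (1 - y) yields [M0 i]. The summand log (1 - x) meets the sum of [C i y] over y,
     which is -1 for i = 0 and 0 otherwise; by [C_La] what remains is the left side of the
     recurrence. *)
  transitivity (\sum_(x | (x != 0) && (x != 1)) \sum_(i < m.+1)
     (ch x * C (m - i) (1 - x) * M0 i
      + ch x * C (m - i) (1 - x) * La (1 - x) * - (val i == 0%N)%:R)).
    apply: eq_bigr => x /andP[x0 x1]; have x10 : 1 - x != 0 by rewrite subr_eq0 eq_sym.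
    under [RHS]eq_bigr => i _.
      rewrite -sum_C; last by have := ltn_ord i; rewrite /=; lia.
      rewrite /M0 !mulr_sumr -big_split /=; over.
    rewrite exchange_big /=; apply: eq_bigr => y /andP[y0 y1].
    have y10 : 1 - y != 0 by rewrite subr_eq0 eq_sym.
    rewrite natr_dlogM // natr_bin_dlogM // mulr_sumr mulr_suml.
    by apply: eq_bigr => i _; ring.
  rewrite exchange_big /=; under eq_bigr => i _ do rewrite big_split /= -!mulr_suml.
  rewrite big_split /=; congr (_ + _).
  rewrite big_ord_recl [X in _ + X]big1 => [|i _]; last by rewrite /= oppr0 mulr0.
  rewrite /= addr0 subn0 mulrN1; congr (- _).
  under eq_bigr => x _ do rewrite -mulrA C_La mulrDr !(mulrCA (ch x)).
  by rewrite big_split /= -!mulr_sumr.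
under eq_bigr => i _ do rewrite mulrBr.
by rewrite sumrB -T1 T0; ring.
Qed.

(** The recurrence is triangular in both directions: m + 1 is invertible mod l, and V_m comes with
    the unit coefficient U_0 = -1. *)
Lemma jacobi_coef_vanish k : (k <= l - 1)%N ->
  (forall m, (0 < m < k)%N -> U m = 0)
  <-> (forall i, (i + 2 <= k)%N ->
         \sum_(y | (y != 0) && (y != 1)) (ch y - 1) * C i y * La (1 - y) = 0).
Proof.
have M10 i : \sum_(y | (y != 0) && (y != 1)) (ch y - 1) * C i y * La (1 - y) = M1 i - M0 i.
  by rewrite -sumrB; apply: eq_bigr => y _; ring.
move=> le_kl; split=> [U_0 i lt_ik | M_0']; last first.
  have M_0 i : (i + 2 <= k)%N -> M1 i = M0 i.
    by move/M_0'/eqP; rewrite M10 subr_eq0 => /eqP.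
  elim/ltn_ind=> [[|m]] // IHm lt_mk.
  have lt_ml : (m.+2 < l)%N by lia.
  have := jacobi_coef_rec lt_ml; rewrite big1 => [|i _]; last first.
    by rewrite M_0 ?subrr ?mulr0 //; have := ltn_ord i; lia.
  have -> : m%:R * U m = 0.
    by case: m {lt_ml} IHm lt_mk => [|m] IHm lt_mk; rewrite ?mul0r ?IHm ?mulr0 //; lia.
  by rewrite addr0; apply: (natr_mulf_eq0 charR); lia.
apply/eqP; rewrite M10 subr_eq0; apply/eqP.
elim/ltn_ind: i lt_ik => i IHi lt_ik.
have lt_il : (i.+2 < l)%N by lia.
have := jacobi_coef_rec lt_il; rewrite U_0; last by lia.
rewrite big_ord_recr /= subnn jacobi_coef0 big1 => [|j _]; last first.
  by rewrite U_0 ?mul0r //; have := ltn_ord j; lia.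
have -> : i%:R * U i = 0.
  by case: i {IHi lt_il} lt_ik => [|i] lt_ik; rewrite ?mul0r ?U_0 ?mulr0 //; lia.
by rewrite mulr0 !add0r mulN1r => /esym/eqP; rewrite oppr_eq0 subr_eq0 => /eqP.
Qed.

End JacobiCocycle.

(** * Logarithms of the cyclotomic units *)

Lemma sum_nat_residue (V : nmodType) (G : nat -> V) e d c : (c < e)%N ->
  \sum_(0 <= n < d * e | (n %% e)%N == c) G n = \sum_(0 <= t < d) G (t * e + c)%N.
Proof.
move=> lt_ce; elim: d => [|d IHd]; first by rewrite !big_geq.
rewrite big_nat_recr //= -IHd mulSnr (big_cat_nat (n := (d * e)%N)) ?leq_addr //=.
congr (_ + _); rewrite -{1}[(d * e)%N]add0n big_addn addKn.
rewrite big_mkord (big_pred1 (Ordinal lt_ce)) => [|n] /=; first by rewrite addnC.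
by rewrite addnC modnMDl modn_small.
Qed.

Lemma sum_nat_reflect (V : nmodType) n (G : nat -> V) : G 0%N = G n ->
  \sum_(0 <= r < n) G r = \sum_(0 <= r < n) G (n - r)%N.
Proof.
case: n => [|n] G0n; first by rewrite !big_geq.
rewrite big_nat_recl // addrC G0n -(big_nat_recr n 0 (fun r => G r.+1)) //.
rewrite [LHS]big_nat_rev /=; apply: eq_big_nat => r /andP[_ lt_rn].
by congr G; lia.
Qed.

Lemma coprime_exp_inj (K : fieldType) (a b : nat) (x y : K) :
  coprime a b -> x != 0 -> y != 0 -> x ^+ a = y ^+ a -> x ^+ b = y ^+ b -> x = y.
Proof.
move=> co_ab x0 y0 xya xyb; have [a0|a_gt0] := posnP a.
  by move: co_ab xyb; rewrite a0 /coprime gcd0n => /eqP->.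
have [u v Duv _] := egcdnP b a_gt0.
have {}Duv : (v * b).+1 = (u * a)%N by rewrite Duv (eqP co_ab) addn1.
apply: (mulfI (expf_neq0 (v * b) x0)).
rewrite -exprSr Duv; have -> : x ^+ (v * b) = y ^+ (v * b) by rewrite mulnC !exprM xyb.
by rewrite -exprSr Duv mulnC !exprM xya.
Qed.

Section CyclotomicUnits.

Variables (l f : nat) (l_pr : prime l) (f_pr : prime f) (l_neq_f : l <> f).
Variables (F : finFieldType) (g : {unit F}).
Hypothesis g_gen : generator [set: {unit F}] g.

Local Notation N := #|F|.-1.
Local Notation log := (dlog g).

Hypothesis lf_dvd_N : (l * f %| N)%N.
Variables xil xif : F.
Hypotheses (xil_root : xil ^+ l = 1) (xif_root : xif ^+ f = 1).
Hypothesis xil_f : xil ^+ f = root_of_generator g (l * f) ^+ f.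
Hypothesis xif_l : xif ^+ l = root_of_generator g (l * f) ^+ l.

Variable R : comNzRingType.
Hypothesis charR : l \in [pchar R].

Let La x : R := (log x)%:R.
Local Notation z := (root_of_generator g (l * f)).
Let d := (N %/ (l * f))%N.

Let co_lf : coprime l f.
Proof. by rewrite prime_coprime // dvdn_prime2 //; apply/eqP. Qed.

Let l_dvd_N : (l %| N)%N. Proof. exact: dvdn_trans (dvdn_mulr f (dvdnn l)) lf_dvd_N. Qed.

Let N_de : (N = d * (l * f))%N. Proof. by rewrite divnK. Qed.

Let N_gt0 : (0 < N)%N. Proof. by rewrite -(order_unit_generator g_gen) order_gt0. Qed.

Let lf_gt0 : (0 < l * f)%N. Proof. by rewrite muln_gt0 !prime_gt0. Qed.

Let d_gt0 : (0 < d)%N. Proof. by move: N_gt0; rewrite N_de muln_gt0 => /andP[]. Qed.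

Lemma prim_root_of_generator : (l * f)%N.-primitive_root z.
Proof. exact: (dvdn_prim_root (prim_root_generator g_gen)). Qed.

(** Both sides have the same l-th powers and the same f-th powers, and l and f are coprime. *)
Lemma xi_mul_eq n r j : n = r %[mod l] -> n = j %[mod f] -> xil ^+ r * xif ^+ j = z ^+ n.
Proof.
have xi0 (x : F) p : prime p -> x ^+ p = 1 -> x != 0.
  move=> p_pr xp1; apply/eqP=> x0; move/eqP: xp1.
  by rewrite x0 expr0n eqn0Ngt prime_gt0 // eq_sym oner_eq0.
have xil0 := xi0 _ _ l_pr xil_root; have xif0 := xi0 _ _ f_pr xif_root.
move=> n_r n_j; have zl n' : z ^+ n' ^+ l = xif ^+ (n' %% f) ^+ l.
  by rewrite exprAC -xif_l exprAC expr_mod.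
have zf n' : z ^+ n' ^+ f = xil ^+ (n' %% l) ^+ f by rewrite exprAC -xil_f exprAC expr_mod.
apply: (coprime_exp_inj co_lf); rewrite ?mulf_neq0 ?expf_neq0 ?unit_generator_neq0 //.
  by rewrite zl n_j exprMn (exprAC xil) xil_root expr1n mul1r expr_mod.
by rewrite zf n_r exprMn (exprAC xif) xif_root expr1n mulr1 expr_mod.
Qed.

Let La_prod I (r : seq I) (P : pred I) (G : I -> F) : (forall i, P i -> G i != 0) ->
  \prod_(i <- r | P i) G i != 0 /\
  La (\prod_(i <- r | P i) G i) = \sum_(i <- r | P i) La (G i).
Proof.
move=> G0; apply: (big_rec2 (fun p s => p != 0 /\ La p = s)) => [|i p s Pi [p0 <-]].
  by rewrite oner_eq0 /La (dlog1 g_gen).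
by rewrite mulf_neq0 ?G0 // /La (natr_dlogM charR g_gen l_dvd_N) ?G0.
Qed.

Let La_exp x n : x != 0 -> La (x ^+ n) = n%:R * La x.
Proof.
move=> x0; rewrite -{1}[n]subn0 -prodr_const_nat (La_prod _ (fun _ _ => x0)).2.
by rewrite sumr_const_nat subn0 mulr_natl.
Qed.

(* This is X^d - 1 = \prod_t (X - h^t), h = g^(l f), evaluated at X = g^(-c).   *)
Lemma prod_one_sub_coset c :
  \prod_(0 <= t < d) (1 - val g ^+ (t * (l * f) + c)) = 1 - z ^+ c.
Proof.
have prim_h : d.-primitive_root (val g ^+ (l * f)).
  have d_dvd_N : (d %| N)%N by rewrite N_de dvdn_mulr.
  by have := dvdn_prim_root (prim_root_generator g_gen) d_dvd_N; rewrite N_de mulKn.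
have gc0 : val g ^+ c != 0 by apply: unit_generator_exp_neq0.
have := congr1 (fun p => p.[(val g ^+ c)^-1]) (factor_Xn_sub_1 prim_h).
rewrite horner_prod !hornerE => /(congr1 (fun x => (val g ^+ c) ^+ d * x)).
rewrite mulrBr mulr1 -exprMn divff // expr1n -[(val g ^+ c) ^+ d]exprM.
rewrite /root_of_generator -exprM -/d (mulnC d) => <-.
rewrite exprM -[X in _ ^+ X]subn0 -prodr_const_nat -big_split /=.
apply: eq_bigr => t _; rewrite hornerXsubC mulrBr mulfV //.
by rewrite addnC exprD (mulnC t) exprM.
Qed.

(** The logarithm of [prod_one_sub_coset], with the coset described by two congruences; since l f
    does not divide n, the coset misses 1 and no factor vanishes. *)
Lemma natr_dlog_one_sub n : ~~ (l * f %| n)%N ->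
  La (1 - z ^+ n) =
  \sum_(y | (y != 0) && ((log y == n %[mod l]) && (log y == n %[mod f]))) La (1 - y).
Proof.
move=> lfNn; under eq_bigl => y do rewrite -chinese_remainder //.
have lt_c := ltn_pmod n lf_gt0.
have -> : z ^+ n = z ^+ (n %% (l * f)).
  by rewrite expr_mod ?(prim_expr_order prim_root_of_generator).
transitivity (\sum_(y | (y != 0) && (log y == n %[mod l * f])) La (1 - val g ^+ log y)).
  rewrite -prod_one_sub_coset (La_prod _ _).2; last first.
    move=> t _; rewrite subr_eq0 eq_sym -(expr0 (val g)) (eq_exp_generator g_gen) mod0n.
    apply: contra lfNn => N_dv; have := dvdn_trans lf_dvd_N N_dv.
    by rewrite (dvdn_addr _ (dvdn_mull t (dvdnn _))) /dvdn modn_mod.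
  rewrite (sum_dlog_nat g_gen (fun m => m == n %[mod l * f]) (fun m => La (1 - val g ^+ m))).
  by rewrite N_de (sum_nat_residue _ _ lt_c).
by apply: eq_bigr => y /andP[y0 _]; rewrite (dlogK g_gen y0).
Qed.

Lemma one_sub_xi_neq0 r j : ~~ (f %| j)%N -> 1 - xil ^+ r * xif ^+ j != 0.
Proof.
move=> fNj; rewrite (@xi_mul_eq (chinese l f r j)) ?chinese_modl ?chinese_modr //.
rewrite subr_eq0 eq_sym -(prim_order_dvd prim_root_of_generator).
apply: contra fNj => lf_dv; have := dvdn_trans (dvdn_mull l (dvdnn f)) lf_dv.
by rewrite /dvdn chinese_modr.
Qed.

Lemma natr_dlog_one_sub_xi r j : ~~ (f %| j)%N ->
  La (1 - xil ^+ r * xif ^+ j) =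
  \sum_(y | (y != 0) && ((log y == r %[mod l]) && (log y == j %[mod f]))) La (1 - y).
Proof.
move=> fNj; have := one_sub_xi_neq0 r fNj.
rewrite (@xi_mul_eq (chinese l f r j)) ?chinese_modl ?chinese_modr // => xi0.
rewrite natr_dlog_one_sub ?chinese_modl ?chinese_modr //.
by rewrite (prim_order_dvd prim_root_of_generator) eq_sym -subr_eq0.
Qed.

Lemma eta_prod_neq0 i j : ~~ (f %| j)%N -> eta_prod l xil xif i j != 0.
Proof.
move=> fNj; rewrite (La_prod _ _).1 // => r _.
by rewrite expf_neq0 ?one_sub_xi_neq0.
Qed.

Lemma natr_dlog_eta_prod i j : ~~ (f %| j)%N ->
  La (eta_prod l xil xif i j)
  = \sum_(0 <= r < l) 'C(r, i)%:R * La (1 - xil ^+ r * xif ^+ j).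
Proof.
move=> fNj; have xi0 r := one_sub_xi_neq0 r fNj.
rewrite (La_prod _ _).2 => [|r _]; last by rewrite expf_neq0.
by apply: eq_bigr => r _; rewrite La_exp.
Qed.

(** The weight C(r, i) equals C(log y, i) mod l on the class log y = r mod l, so the sums over r
    merge into one sum over y. *)
Lemma natr_dlog_eta_prod_sum i j : (i < l)%N -> ~~ (f %| j)%N ->
  La (eta_prod l xil xif i j)
  = \sum_(y | (y != 0) && (log y == j %[mod f])) 'C(log y, i)%:R * La (1 - y).
Proof.
move=> lt_il fNj; rewrite natr_dlog_eta_prod // big_mkord.
under eq_bigr => r _ do rewrite natr_dlog_one_sub_xi // mulr_sumr.
rewrite (exchange_big_dep [pred y | (y != 0) && (log y == j %[mod f])]) /=; last first.
  by move=> r y _ /and3P[-> _ ->].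
apply: eq_bigr => y /andP[y0 y_j].
have lt_yl : (log y %% l < l)%N by rewrite ltn_mod prime_gt0.
rewrite (big_pred1 (Ordinal lt_yl)) => [|r] /=.
  by congr (_ * _); apply: (natr_bin_eq_modn charR) => //; rewrite modn_mod.
by rewrite y0 y_j andbT /= (modn_small (ltn_ord r)) eq_sym.
Qed.

Lemma unit_powerP x : x != 0 -> unit_power l x <-> La x = 0.
Proof.
move=> x0; have -> : La x = 0 <-> (l %| log x)%N.
  by rewrite (dvdn_pcharf charR); split=> /eqP.
split=> [[u Du] | /dvdnP[n Dn]]; last first.
  by exists (g ^+ n)%g; rewrite FinRing.val_unitX -exprM -Dn dlogK.
have u0 : val u != 0 by rewrite -unitfE (valP u).
have: log x = (log (val u) * l)%N %[mod N].
  by apply/eqP; rewrite -(eq_exp_generator g_gen) exprM !dlogK // Du.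
by move/(congr1 (modn^~ l)); rewrite !modn_dvdm // modnMl /dvdn => ->.
Qed.

(* The C(l - s, i) are combinations mod l of the C(s, a), a <= i.               *)
Lemma sum_bin_reflect (w : nat -> R) i : (i < l)%N ->
    (forall a, (a <= i)%N -> \sum_(0 <= s < l) 'C(s, a)%:R * w s = 0) ->
  \sum_(0 <= s < l) 'C(l - s, i)%:R * w s = 0.
Proof.
move=> lt_il w0.
(* Mixed weights C(s, a) C(l - s, b) allow induction on b: as l - s = - s in R, lowering b costs a
   factor - s, which [muln_bin] absorbs into C(s, a). *)
suffices H b a : (a + b <= i)%N -> \sum_(0 <= s < l) 'C(s, a)%:R * 'C(l - s, b)%:R * w s = 0.
  by rewrite -[RHS](H i 0%N) //; apply: eq_bigr => s _; rewrite bin0 mul1r.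
elim: b a => [|b IHb] a le_abi.
  by rewrite -[RHS](w0 a); [apply: eq_bigr => s _; rewrite bin0 mulr1 | lia].
apply: (@natr_mulf_eq0 l R charR b.+1); first lia.
have le1 : (a.+1 + b <= i)%N by lia.
have le0 : (a + b <= i)%N by lia.
rewrite mulr_sumr.
transitivity (- (a.+1%:R * \sum_(0 <= s < l) 'C(s, a.+1)%:R * 'C(l - s, b)%:R * w s
  + (a + b)%:R * \sum_(0 <= s < l) 'C(s, a)%:R * 'C(l - s, b)%:R * w s)); last first.
  by rewrite !IHb // !mulr0 addr0 oppr0.
rewrite !mulr_sumr -big_split /= -sumrN; apply: eq_big_nat => s /andP[_ lt_sl].
have Ds : (l - s)%:R = - s%:R :> R by rewrite natrB 1?ltnW // (pcharf0 charR) sub0r.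
have E1 := congr1 (fun n => n%:R : R) (muln_bin s a).
have E2 := congr1 (fun n => n%:R : R) (muln_bin (l - s) b).
move: E1 E2; rewrite /= !natrD !natrM Ds => E1 E2.
have {}E1 : a.+1%:R * 'C(s, a.+1)%:R = 'C(s, a)%:R * s%:R - a%:R * 'C(s, a)%:R :> R.
  by rewrite E1; ring.
have {}E2 : b.+1%:R * 'C(l - s, b.+1)%:R = 'C(l - s, b)%:R * - s%:R - b%:R * 'C(l - s, b)%:R :> R.
  by rewrite E2; ring.
transitivity ('C(s, a)%:R * (b.+1%:R * 'C(l - s, b.+1)%:R) * w s); first by ring.
transitivity (- ((a.+1%:R * 'C(s, a.+1)%:R) * 'C(l - s, b)%:R * w s
  + (a%:R + b%:R) * ('C(s, a)%:R * 'C(l - s, b)%:R * w s))); last by ring.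
by rewrite E1 E2; ring.
Qed.

(* From 1 - xil^r xif^(-j) = - xil^r xif^(-j) (1 - xil^(-r) xif^j); the         *)
(* monomial factors contribute l-th powers since i + 2 < l.                     *)
Lemma eta_prod_reflect i j : (i.+2 < l)%N -> (0 < j < f)%N ->
    (forall a, (a <= i)%N -> La (eta_prod l xil xif a j) = 0) ->
  La (eta_prod l xil xif i (f - j)) = 0.
Proof.
move=> lt_il /andP[j_gt0 lt_jf] eta0.
have fNj : ~~ (f %| j)%N by rewrite gtnNdvd.
have fNfj : ~~ (f %| f - j)%N by rewrite gtnNdvd ?subn_gt0 // ltn_subrL j_gt0 prime_gt0.
pose w s := La (1 - xil ^+ s * xif ^+ j).
have xif0 : xif != 0.
  by apply/eqP=> x0; move/eqP: xif_root; rewrite x0 expr0n eqn0Ngt prime_gt0 // eq_sym oner_eq0.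
have xil0 : xil != 0.
  by apply/eqP=> x0; move/eqP: xil_root; rewrite x0 expr0n eqn0Ngt prime_gt0 // eq_sym oner_eq0.
have LaM := natr_dlogM charR g_gen l_dvd_N.
rewrite natr_dlog_eta_prod //.
transitivity (\sum_(0 <= r < l) ('C(r, i)%:R * La (- xif ^+ (f - j))
   + 'C(r, i)%:R * r%:R * La xil + 'C(r, i)%:R * w (l - r)%N)).
  apply: eq_big_nat => r /andP[_ lt_rl]; rewrite -mulrA -!mulrDr; congr (_ * _).
  have -> : 1 - xil ^+ r * xif ^+ (f - j)
          = - xif ^+ (f - j) * xil ^+ r * (1 - xil ^+ (l - r) * xif ^+ j).
    have E1 : xif ^+ (f - j) * xif ^+ j = 1 by rewrite -exprD subnK ?xif_root // ltnW.
    have E2 : xil ^+ r * xil ^+ (l - r) = 1 by rewrite -exprD subnKC ?xil_root // ltnW.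
    transitivity (xil ^+ r * xil ^+ (l - r) * (xif ^+ (f - j) * xif ^+ j)
                  - xil ^+ r * xif ^+ (f - j)); first by rewrite E1 E2 mulr1.
    by ring.
  rewrite /La !LaM ?mulf_neq0 ?oppr_eq0 ?expf_neq0 ?one_sub_xi_neq0 //.
  by rewrite -/(La _) -/(La (xil ^+ _)) La_exp.
rewrite !big_split /= -!mulr_suml (sum_bin_eq0 charR) 1?ltnW //.
rewrite (sum_natr_mul_bin_eq0 charR) // !mul0r !add0r.
(* The substitution s = l - r trades the index 0 for l; the two end terms agree because xil^l = 1
   and C(l, i) = C(0, i) mod l. *)
rewrite sum_nat_reflect; last first.
  rewrite subn0 subnn /w xil_root expr0; congr (_ * _).
  apply: (natr_bin_eq_modn charR); last by rewrite modnn mod0n.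
  exact: ltn_trans (ltnSn i) (ltnW lt_il).
transitivity (\sum_(0 <= s < l) 'C(l - s, i)%:R * w s).
  by apply: eq_big_nat => s /andP[_ lt_sl]; rewrite subKn // ltnW.
apply: sum_bin_reflect => [|a le_ai]; first exact: ltn_trans (ltnSn i) (ltnW lt_il).
by rewrite -natr_dlog_eta_prod // eta0.
Qed.

End CyclotomicUnits.

(** * Cyclotomic integers modulo l *)

Lemma eq_mod_coprime_mull d c m n : coprime d c ->
  (c * m = c * n %[mod d] -> m = n %[mod d])%N.
Proof.
move=> co_dc; wlog le_nm : m n / (n <= m)%N => [IH | /eqP cm_cn].
  by have [/IH // | /ltnW/IH IHnm /esym/IHnm/esym] := leqP n m.
apply/eqP; rewrite eqn_mod_dvd // -(Gauss_dvdr _ co_dc) mulnBr -eqn_mod_dvd //.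
by rewrite leq_mul2l le_nm orbT.
Qed.

(* R is F_l[X] / (1 + X + ... + X^(f - 1)), i.e. Z[zeta_f] / l.                 *)
Lemma prime_cyclotomic_quotient (l f : nat) : prime l -> prime f ->
  exists (R : comNzRingType) (theta : R),
    [/\ l \in [pchar R], \sum_(0 <= a < f) theta ^+ a = 0
      & forall s : nat -> nat, \sum_(0 <= a < f) (s a)%:R * theta ^+ a = 0 ->
          forall a, (a < f)%N -> s a = s 0 %[mod l]].
Proof.
move=> l_pr f_pr; have f_gt1 := prime_gt1 f_pr.
have charFl : l \in [pchar 'F_l] by apply: pchar_Fp.
pose h : {poly 'F_l} := \poly_(i < f) 1.
have size_h : size h = f by rewrite size_poly_eq ?oner_eq0.
have mon_h : h \is monic.
  by rewrite monicE lead_coefE size_h coef_poly prednK ?prime_gt0 // leqnn.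
have Dh : mk_monic h = h by rewrite /mk_monic size_h f_gt1 mon_h.
have sumE (c : nat -> 'F_l) : in_qpoly h (\poly_(a < f) c a)
    = \sum_(0 <= a < f) in_qpoly h (c a)%:P * in_qpoly h 'X ^+ a.
  rewrite poly_def rmorph_sum big_mkord; apply: eq_bigr => a _.
  by rewrite -mul_polyC rmorphM rmorphXn.
exists {poly %/ h}, (in_qpoly h 'X); split.
- by rewrite pchar_qpoly.
- have := sumE (fun=> 1); rewrite -/h.
  have -> : in_qpoly h h = 0 by apply/val_inj; rewrite /= Dh Pdiv.RingMonic.rmodpp.
  by move=> E; rewrite [RHS]E; apply: eq_bigr => a _; rewrite rmorph1 mul1r.
move=> s s0 a lt_af.
(* Subtracting c times h kills the coefficient of degree f - 1, so p is its own reduced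
   representative and must be 0. *)
pose c := (s f.-1)%:R : 'F_l; pose p := \poly_(a < f) ((s a)%:R - c).
have p0 : in_qpoly h p = 0.
  rewrite (sumE (fun a => (s a)%:R - c)) -[RHS]s0 -[RHS]subr0.
  rewrite -[X in _ = _ - X](_ : in_qpoly h (c%:P * h) = 0); last first.
    by apply/val_inj; rewrite /= Dh Pdiv.RingMonic.rmodp_mull.
  rewrite in_qpolyM [in_qpoly h h](sumE (fun=> 1)) mulr_sumr -sumrB; apply: eq_bigr => i _.
  by rewrite polyCB rmorphB mulrBl polyCMn !rmorphMn !rmorph1 mul1r.
have p_eq0 : p = 0.
  rewrite -[p](in_qpoly_small (h := h)) ?p0 // Dh size_h.
  rewrite -(prednK (prime_gt0 f_pr)) ltnS; apply/leq_sizeP=> i le_fi.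
  rewrite coef_poly; case: ltnP => // lt_if.
  by have -> : i = f.-1 by [lia]; rewrite subrr.
have sE i : (i < f)%N -> s i = s f.-1 %[mod l].
  move=> lt_if; have := congr1 (fun q : {poly _} => q`_i) p_eq0.
  rewrite coef_poly lt_if coef0 => /eqP; rewrite subr_eq0 => /eqP/(congr1 val).
  by rewrite /= !val_Fp_nat.
by rewrite !sE ?prime_gt0.
Qed.

Lemma sum_exp_prim_root (K : fieldType) f (th : K) n : f.-primitive_root th ->
  \sum_(0 <= b < f) th ^+ (n * b) = if (f %| n)%N then f%:R else 0.
Proof.
move=> th_prim; rewrite (prim_order_dvd th_prim).
under eq_bigr => b _ do rewrite exprM.
case: eqP => [-> | /eqP th_n1].
  by under eq_bigr => b _ do rewrite expr1n; rewrite sumr_const_nat subn0.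
apply: (mulfI (_ : th ^+ n - 1 != 0)); first by rewrite subr_eq0.
by rewrite big_mkord -subrX1 exprAC (prim_expr_order th_prim) expr1n subrr mulr0.
Qed.

Lemma prod_prim_root_sub1 (l : nat) (om : algC) : l.-primitive_root om ->
  \prod_(1 <= r < l) (1 - om ^+ r) = l%:R.
Proof.
move=> om_prim; have l_gt0 := prim_order_gt0 om_prim.
have := factor_Xn_sub_1 om_prim; rewrite big_ltn // expr0 subrX1.
move/(mulfI (negbT (polyXsubC_eq0 1)))/(congr1 (fun p => p.[1])).
rewrite horner_prod horner_sum => E; transitivity (\sum_(i < l) 'X^i.[1] : algC).
  by rewrite -E; apply: eq_bigr => r _; rewrite hornerXsubC.
under eq_bigr => i _ do rewrite hornerXn expr1n.
by rewrite sumr_const card_ord.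
Qed.

Lemma Aint_exp_sub1_dvd (x : algC) n : x \in Aint ->
  exists2 y, y \in Aint & x ^+ n - 1 = (x - 1) * y.
Proof.
move=> Zx; exists (\sum_(i < n) x ^+ i); last exact: subrX1.
by apply: rpred_sum => i _; apply: rpredX.
Qed.

(** For 0 < r < l, om is a power of om^r, so 1 - om^r divides om - 1 and hence k = m - n.
    Multiplying over r, l divides k^(l - 1) among algebraic integers, hence in Z. *)
Lemma natr_prim_root_sub1_dvd (l : nat) (om y : algC) (m n : nat) :
    prime l -> l.-primitive_root om -> y \in Aint ->
  m%:R - n%:R = (om - 1) * y -> m = n %[mod l].
Proof.
move=> l_pr om_prim.
wlog le_nm : m n y / (n <= m)%N => [IH | Zy].
  move=> Zy Dy; have [le_nm | /ltnW le_mn] := leqP n m; first exact: (IH m n y).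
  by apply/esym/(IH n m (- y)); rewrite ?rpredN // mulrN -Dy opprB.
rewrite -natrB // => Dy; apply/eqP; rewrite eqn_mod_dvd //.
set k := (m - n)%N in Dy *.
have Zom : om \in Aint by apply: Aint_prim_root om_prim.
have Ew r : (0 < r < l)%N -> exists w, (w \in Aint) && (k%:R == (1 - om ^+ r) * w).
  move=> /andP[r_gt0 lt_rl].
  have co_rl : coprime r l by rewrite coprime_sym prime_coprime // gtnNdvd.
  have [u v Duv _] := egcdnP l r_gt0.
  have Dom : om = om ^+ r ^+ u.
    rewrite -exprM mulnC Duv (eqP co_rl) exprD expr1 mulnC exprM.
    by rewrite (prim_expr_order om_prim) expr1n mul1r.
  have [w Zw Dw] := Aint_exp_sub1_dvd u (rpredX r Zom).
  exists (- (w * y)); rewrite rpredN rpredM //= Dy {1}Dom Dw; apply/eqP; ring.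
have [w Zw Dw] : exists2 w : algC, w \in Aint & k%:R ^+ l.-1 = l%:R * w.
  rewrite -(prod_prim_root_sub1 om_prim) -[l.-1]subn1 -prodr_const_nat !(big_nat _ _ 1).
  apply: (big_rec2 (fun a b => exists2 w, w \in Aint & a = b * w)) => [|r a b lt_rl [w Zw Dw]].
    by exists 1; rewrite ?mulr1 ?rpred1.
  have [w' /andP[Zw' /eqP Dw']] := Ew r lt_rl.
  by exists (w' * w); rewrite ?rpredM // Dw Dw'; ring.
have: (l %| k ^ l.-1)%N.
  by rewrite -eqAmod0_nat; have := eqAmodMr0 (l%:R : algC) Zw; rewrite -Dw -natrX.
by rewrite Euclid_dvdX // => /andP[].
Qed.

(* The Galois conjugates fixing om turn the hypothesis into divisibility of all *)
(* \sum_a s_a th^(a b), 0 < b < f; Fourier inversion then makes                *)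
(* f (s_c - s_0) a multiple of om - 1, hence of l.                              *)
Lemma sum_prim_root_dvd (l f : nat) (om th y : algC) (s : nat -> nat) :
    prime l -> prime f -> l <> f ->
    l.-primitive_root om -> f.-primitive_root th -> y \in Aint ->
    \sum_(0 <= a < f) (s a)%:R * th ^+ a = (om - 1) * y ->
  forall a, (a < f)%N -> s a = s 0 %[mod l].
Proof.
move=> l_pr f_pr l_neq_f om_prim th_prim Zy Dy c lt_cf.
have co_lf : coprime l f by rewrite prime_coprime // dvdn_prime2 //; apply/eqP.
have Zth : th \in Aint by apply: Aint_prim_root th_prim.
have conj b : (0 < b < f)%N ->
    exists y', (y' \in Aint) && (\sum_(0 <= a < f) (s a)%:R * th ^+ (a * b) == (om - 1) * y').
  move=> /andP[b_gt0 lt_bf]; pose k := chinese l f 1 b.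
  have kl : k = 1 %[mod l] by rewrite chinese_modl.
  have kf : k = b %[mod f] by rewrite chinese_modr.
  have co_k : coprime k (l * f).
    rewrite coprimeMr -coprime_modl kl coprime_modl coprime1n.
    by rewrite -coprime_modl kf coprime_modl coprime_sym prime_coprime // gtnNdvd.
  have [u Du] := Qn_aut_exists co_k.
  have u_om : u om = om.
    rewrite Du ?exprM ?(prim_expr_order om_prim) ?expr1n //.
    by rewrite -(prim_expr_mod om_prim) kl (prim_expr_mod om_prim).
  have u_th : u th = th ^+ b.
    rewrite Du 1?mulnC ?exprM ?(prim_expr_order th_prim) ?expr1n //.
    by rewrite -(prim_expr_mod th_prim) kf (prim_expr_mod th_prim).
  exists (u y); rewrite Aint_aut Zy /=; apply/eqP.
  have -> : (om - 1) * u y = u ((om - 1) * y) by rewrite rmorphM rmorphB rmorph1 u_om.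
  rewrite -Dy rmorph_sum; apply: eq_bigr => a _.
  by rewrite rmorphM rmorph_nat rmorphXn u_th (mulnC a) exprM.
pose T b := \sum_(0 <= a < f) (s a)%:R * th ^+ (a * b).
(* The weights th^((f - c) b) - 1 extract f (s_c - s_0) by orthogonality and vanish at b = 0, the
   one index that [conj] does not cover. *)
have [y' Zy' Dy'] : exists2 y', y' \in Aint &
    \sum_(0 <= b < f) (th ^+ ((f - c) * b) - 1) * T b = (om - 1) * y'.
  rewrite big_nat.
  apply: (big_rec (fun z => exists2 y', y' \in Aint & z = (om - 1) * y'))
    => [|b z lt_bf [y' Zy' ->]].
    by exists 0; rewrite ?rpred0 ?mulr0.
  have [-> | b_gt0] := posnP b.
    by rewrite muln0 expr0 subrr mul0r add0r; exists y'.
  have [|y'' /andP[Zy'' /eqP Dy'']] := conj b; first by rewrite b_gt0; case/andP: lt_bf.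
  exists ((th ^+ ((f - c) * b) - 1) * y'' + y'); last by rewrite /T Dy''; ring.
  by rewrite rpredD ?rpredM ?rpredB ?rpredX ?rpred1.
have sumT n : (0 < n <= f)%N ->
    \sum_(0 <= b < f) th ^+ (n * b) * T b = (f * s ((f - n)%N))%:R.
  move=> /andP[n_gt0 le_nf].
  transitivity (\sum_(0 <= a < f) (s a)%:R * (if (f %| n + a)%N then f%:R else 0) : algC).
    under eq_bigr => b _ do rewrite /T mulr_sumr.
    rewrite exchange_big /=; apply: eq_bigr => a _.
    rewrite -(sum_exp_prim_root _ th_prim) mulr_sumr; apply: eq_bigr => b _.
    by rewrite mulnDl exprD mulrCA.
  have lt_fnf : (f - n < f)%N by lia.
  rewrite big_mkord (bigD1 (Ordinal lt_fnf)) //= subnKC // dvdnn big1 ?addr0 => [|a].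
    by rewrite natrM mulrC.
  rewrite -val_eqE /= => neq_a; case: ifP => [/dvdnP[t Dt]|]; last by rewrite mulr0.
  have := ltn_ord a; case: t Dt => [|[|t]] Dt lt_af; [lia | lia |].
  by have : (f * 2 <= n + a)%N by [rewrite Dt; nia]; lia.
have : (f * s c = f * s 0 %[mod l])%N.
  apply: (natr_prim_root_sub1_dvd l_pr om_prim Zy'); rewrite -Dy'.
  under [RHS]eq_bigr => b _ do rewrite mulrBl.
  rewrite sumrB sumT; last by lia.
  have := sumT f; rewrite subnn => <-; last by rewrite prime_gt0 // leqnn.
  rewrite subKn 1?ltnW //; congr (_ - _); apply: eq_bigr => b _.
  by rewrite exprM (prim_expr_order th_prim) expr1n.
exact: eq_mod_coprime_mull.
Qed.

(** * Expansion of the Jacobi sum in powers of a uniformizer *)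

Lemma sum_exp_period (R : pzRingType) (theta : R) f d : theta ^+ f = 1 ->
  \sum_(0 <= a < f) theta ^+ a = 0 -> \sum_(0 <= n < d * f) theta ^+ n = 0.
Proof.
move=> theta_f sum0; elim: d => [|d IHd]; first by rewrite big_geq.
rewrite mulSnr (big_cat_nat (n := (d * f)%N)) ?leq_addr //= IHd add0r.
rewrite -{1}[(d * f)%N]add0n big_addn addKn -[RHS]sum0; apply: eq_bigr => a _.
by rewrite exprD mulnC exprM theta_f expr1n mulr1.
Qed.

Lemma sum_dlog_class (F : finFieldType) (g : {unit F}) (R : comPzRingType) (theta : R) f
    (P : pred F) (G : F -> nat) : (0 < f)%N -> theta ^+ f = 1 ->
  \sum_(x | P x) theta ^+ dlog g x * (G x)%:R
  = \sum_(0 <= a < f) (\sum_(x | P x && (dlog g x %% f == a)%N) G x)%:R * theta ^+ a.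
Proof.
move=> f_gt0 theta_f; rewrite big_mkord.
under [RHS]eq_bigr => a _ do rewrite natr_sum mulr_suml.
rewrite (exchange_big_dep P) /=; last by move=> a x _ /andP[].
apply: eq_bigr => x Px; have lt_xf : (dlog g x %% f < f)%N by rewrite ltn_mod.
rewrite (big_pred1 (Ordinal lt_xf)) /= => [|a]; first by rewrite expr_mod // mulrC.
by rewrite Px eq_sym.
Qed.

(** * Arithmetic of Z[z] and its principal ideals *)

Section AdjoinedIntegers.

Variable z : algC.

Lemma Zadjoin_id : Zadjoin z z.
Proof. by exists 'X; rewrite map_polyX hornerX. Qed.

Lemma Zadjoin_nat n : Zadjoin z n%:R.
Proof. by exists n%:R; rewrite rmorph_nat hornerMn hornerC. Qed.

Lemma ZadjoinD x y : Zadjoin z x -> Zadjoin z y -> Zadjoin z (x + y).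
Proof. by move=> [p ->] [q ->]; exists (p + q); rewrite rmorphD hornerD. Qed.

Lemma ZadjoinN x : Zadjoin z x -> Zadjoin z (- x).
Proof. by move=> [p ->]; exists (- p); rewrite rmorphN hornerN. Qed.

Lemma ZadjoinM x y : Zadjoin z x -> Zadjoin z y -> Zadjoin z (x * y).
Proof. by move=> [p ->] [q ->]; exists (p * q); rewrite rmorphM hornerM. Qed.

Lemma ZadjoinX x n : Zadjoin z x -> Zadjoin z (x ^+ n).
Proof. by move=> [p ->]; exists (p ^+ n); rewrite rmorphXn horner_exp. Qed.

Lemma Zadjoin_sum I (r : seq I) (P : pred I) (G : I -> algC) :
  (forall i, P i -> Zadjoin z (G i)) -> Zadjoin z (\sum_(i <- r | P i) G i).
Proof.
move=> ZG; apply: (big_ind (Zadjoin z)) => //; last exact: ZadjoinD.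
exact: (Zadjoin_nat 0).
Qed.

Lemma Zadjoin_Aint x : z \in Aint -> Zadjoin z x -> x \in Aint.
Proof.
move=> Zz [p ->]; rewrite horner_coef; apply: rpred_sum => i _.
by rewrite rpredM ?rpredX // coef_map Aint_int.
Qed.

Lemma Zadjoin_ideal0 a : in_Zadjoin_ideal z a 0.
Proof. by exists 0; rewrite ?mulr0 //; apply: (Zadjoin_nat 0). Qed.

Lemma Zadjoin_idealD a x y :
  in_Zadjoin_ideal z a x -> in_Zadjoin_ideal z a y -> in_Zadjoin_ideal z a (x + y).
Proof.
by move=> [u Zu ->] [v Zv ->]; exists (u + v); [apply: ZadjoinD | rewrite mulrDr].
Qed.

Lemma Zadjoin_idealMl a b x :
  Zadjoin z b -> in_Zadjoin_ideal z a x -> in_Zadjoin_ideal z a (b * x).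
Proof. by move=> Zb [u Zu ->]; exists (b * u); [apply: ZadjoinM | ring]. Qed.

Lemma Zadjoin_idealN a x : in_Zadjoin_ideal z a x -> in_Zadjoin_ideal z a (- x).
Proof. by move=> [u Zu ->]; exists (- u); [apply: ZadjoinN | rewrite mulrN]. Qed.

Lemma Zadjoin_ideal_sum a I (r : seq I) (P : pred I) (G : I -> algC) :
  (forall i, P i -> in_Zadjoin_ideal z a (G i)) ->
  in_Zadjoin_ideal z a (\sum_(i <- r | P i) G i).
Proof.
move=> IG; apply: (big_ind (in_Zadjoin_ideal z a)) => //; last exact: Zadjoin_idealD.
exact: Zadjoin_ideal0.
Qed.

Lemma Zadjoin_ideal_trans a b x : in_Zadjoin_ideal z a b ->
  in_Zadjoin_ideal z b x -> in_Zadjoin_ideal z a x.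
Proof. by move=> [u Zu ->] [v Zv ->]; exists (u * v); [apply: ZadjoinM | ring]. Qed.

Lemma Zadjoin_idealX a b n : in_Zadjoin_ideal z a b -> in_Zadjoin_ideal z (a ^+ n) (b ^+ n).
Proof. by move=> [u Zu ->]; exists (u ^+ n); [apply: ZadjoinX | rewrite exprMn]. Qed.

Lemma Zadjoin_ideal_exp_sub1 x n : Zadjoin z x -> in_Zadjoin_ideal z (x - 1) (x ^+ n - 1).
Proof.
move=> Zx; exists (\sum_(i < n) x ^+ i); last exact: subrX1.
by apply: Zadjoin_sum => i _; apply: ZadjoinX.
Qed.

(** Each of the l - 1 factors 1 - om^r of l is a multiple of om - 1. *)
Lemma Zadjoin_ideal_prim_root_sub1 l om : l.-primitive_root om -> Zadjoin z om ->
  in_Zadjoin_ideal z ((om - 1) ^+ l.-1) l%:R.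
Proof.
move=> om_prim Zom; rewrite -(prod_prim_root_sub1 om_prim) -subn1 -prodr_const_nat.
apply: (big_rec2 (fun a b => in_Zadjoin_ideal z a b)) => [|r a b _ [u Zu ->]].
  by exists 1; rewrite ?mulr1 //; apply: (Zadjoin_nat 1).
have [v Zv Dv] := Zadjoin_ideal_exp_sub1 r Zom.
exists (- v * u); first by apply: ZadjoinM => //; apply: ZadjoinN.
by rewrite -opprB Dv; ring.
Qed.

End AdjoinedIntegers.

(** The coefficient of th^a in u_m, kept in nat so that it can be read both in [algC] and in the
    quotient mod l. *)
Definition jacobi_class_coef (F : finFieldType) (g : {unit F}) (f m a : nat) : nat :=
  (\sum_(x : F | ((x != 0%R) && (x != 1%R)) && (dlog g x %% f == a)) 'C(dlog g (1 - x)%R, m))%N.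

Lemma cfun_at_dlog (F : finFieldType) (g : {unit F}) (xi : 'CF([set: {unit F}])) (x : F) :
    generator [set: {unit F}] g -> xi \is a linear_char -> x != 0 ->
  cfun_at xi x = xi g ^+ dlog g x.
Proof.
move=> g_gen xi_lin x0; rewrite -lin_charX ?inE // /cfun_at; congr (xi _).
by apply: val_inj; rewrite FinRing.val_unitX dlogK // insubdK // unitfE.
Qed.

(** A linear character of a cyclic group is determined by its value at a generator. *)
Lemma prim_root_cforder (F : finFieldType) (g : {unit F}) (xi : 'CF([set: {unit F}])) :
    generator [set: {unit F}] g -> xi \is a linear_char ->
  (#[xi]%CF).-primitive_root (xi g).
Proof.
move=> g_gen xi_lin.
have xi_gX n : (xi g ^+ n == 1) = (#[xi]%CF %| n)%N.
  rewrite dvdn_cforder; apply/eqP/eqP => [gn1 | xin1].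
    apply/cfunP => x; rewrite exp_cfunE ?inE // cfun1E inE.
    have /cycleP[m ->] : x \in <[g]>%g by rewrite -(eqP g_gen) inE.
    by rewrite lin_charX ?inE // exprAC gn1 expr1n.
  by rewrite -exp_cfunE ?inE // xin1 cfun1E inE.
have n_gt0 : (0 < #[xi]%CF)%N.
  apply: (@dvdn_gt0 _ #[g]%g); rewrite ?order_gt0 // -xi_gX -lin_charX ?inE //.
  by rewrite expg_order lin_char1.
rewrite /primitive_root_of_unity n_gt0; apply/forallP => i.
rewrite unity_rootE xi_gX; apply/eqP; apply/idP/eqP => [i_dv | ->] //.
by have := dvdn_leq (ltn0Sn i) i_dv; have := ltn_ord i; lia.
Qed.

(** * Divisibility of J + 1 by powers of p *)

Section JacobiSumExpansion.

Variables (l f : nat) (l_pr : prime l) (f_pr : prime f) (l_neq_f : l <> f).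
Variables (F : finFieldType) (g : {unit F}).
Hypothesis g_gen : generator [set: {unit F}] g.

Local Notation N := #|F|.-1.
Local Notation log := (dlog g).

Hypothesis f_dvd_N : (f %| N)%N.
Variables (zeta om th : algC).
Hypothesis zeta_Aint : zeta \in Aint.
Hypotheses (om_prim : l.-primitive_root om) (th_prim : f.-primitive_root th).
Hypotheses (Zom : Zadjoin zeta om) (Zth : Zadjoin zeta th).

Let J := \sum_(x | (x != 0) && (x != 1)) th ^+ log x * om ^+ log (1 - x).
Let S := jacobi_class_coef g f.
Let p := om - 1.
Let u m := \sum_(0 <= a < f) (S m a)%:R * th ^+ a.

Let f_gt0 : (0 < f)%N. Proof. exact: prime_gt0. Qed.

Let th_sum : \sum_(0 <= a < f) th ^+ a = 0.
Proof.
have := sum_exp_prim_root 1 th_prim; rewrite dvdn1.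
have -> : (f == 1)%N = false by apply/gtn_eqF/prime_gt1.
by move=> E; rewrite -[RHS]E; apply: eq_bigr => a _; rewrite mul1n.
Qed.

Let Zp : Zadjoin zeta p.
Proof. by apply: ZadjoinD => //; apply/ZadjoinN/(Zadjoin_nat _ 1). Qed.

Let Zu m : Zadjoin zeta (u m).
Proof.
by apply: Zadjoin_sum => a _; apply: ZadjoinM; [apply: Zadjoin_nat | apply: ZadjoinX].
Qed.

Let p_neq0 : p != 0.
Proof.
rewrite subr_eq0; apply/eqP => om1.
have := prim_order_dvd om_prim 1; rewrite expr1 om1 eqxx dvdn1 => /eqP l1.
by move: l_pr; rewrite l1.
Qed.

(** Expand om^(log (1 - x)) = (1 + p)^(log (1 - x)) by the binomial theorem; the term m = 0 is -1
    and cancels the added 1. *)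
Lemma jacobi_sum_expansion : J + 1 = \sum_(1 <= m < #|F|) p ^+ m * u m.
Proof.
have F_gt0 : (0 < #|F|)%N by rewrite (cardD1 0) inE.
have uE m : u m = \sum_(x | (x != 0) && (x != 1)) th ^+ log x * 'C(log (1 - x), m)%:R.
  by rewrite (sum_dlog_class _ _ _ f_gt0 (prim_expr_order th_prim)).
have u0 : u 0%N = -1.
  rewrite uE (jacobi_coef0 g_gen) // -(divnK f_dvd_N).
  by rewrite sum_exp_period ?(prim_expr_order th_prim).
have -> : J = \sum_(0 <= m < #|F|) p ^+ m * u m.
  under [RHS]eq_bigr => m _ do rewrite uE mulr_sumr.
  rewrite exchange_big /=; apply: eq_bigr => x /andP[x0 x1].
  have x10 : 1 - x != 0 by rewrite subr_eq0 eq_sym.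
  have lt_xF : ((log (1 - x)%R).+1 <= #|F|)%N.
    exact: leq_trans (ltn_dlog g_gen x10) (leq_pred _).
  rewrite (big_cat_nat (n := (log (1 - x)).+1)) //= [X in _ = _ + X]big1_seq; last first.
    move=> m; rewrite mem_index_iota => /and3P[_ lt_m _].
    by rewrite bin_small ?mulr0.
  rewrite addr0 -[om in LHS](subrK 1) -/p addrC exprDn big_mkord mulr_sumr.
  by apply: eq_bigr => m _; rewrite expr1n mul1r -mulr_natr; ring.
by rewrite big_ltn // u0 expr0 mul1r addrAC addNr add0r.
Qed.

(** If the coefficients of u_m agree mod l, then l divides u_m because the th^a sum to 0, and p^k
    divides l. Conversely, once this holds below m, all terms but p^m u_m are multiples of p^(m +
    1), so p divides u_m and [sum_prim_root_dvd] applies. *)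
Lemma jacobi_sum_ideal k : (k <= l - 1)%N ->
  in_Zadjoin_ideal zeta (p ^+ k) (J + 1) <->
  (forall m, (0 < m < k)%N -> forall a, (a < f)%N -> S m a = S m 0 %[mod l]).
Proof.
move=> le_kl.
have pk_l : in_Zadjoin_ideal zeta (p ^+ k) l%:R.
  have le_kl1 : (k <= l.-1)%N by rewrite -subn1.
  apply: Zadjoin_ideal_trans (Zadjoin_ideal_prim_root_sub1 om_prim Zom).
  exists (p ^+ (l.-1 - k)); first exact: ZadjoinX.
  by rewrite -exprD subnKC.
have pXI m n (x : algC) : (m <= n)%N -> Zadjoin zeta x ->
    in_Zadjoin_ideal zeta (p ^+ m) (p ^+ n * x).
  move=> le_mn Zx; exists (p ^+ (n - m) * x); last by rewrite mulrA -exprD subnKC.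
  by apply: ZadjoinM => //; apply: ZadjoinX.
have uI m : (forall a, (a < f)%N -> S m a = S m 0 %[mod l]) -> in_Zadjoin_ideal zeta (p ^+ k) (u m).
  move=> S_l.
  have -> : u m = (\sum_(0 <= a < f) (S m a %/ l)%N%:R * th ^+ a) * l%:R.
    transitivity (\sum_(0 <= a < f)
      ((S m a %/ l)%N%:R * th ^+ a * l%:R + (S m 0 %% l)%N%:R * th ^+ a) : algC).
      apply: eq_big_nat => a /andP[_ lt_af].
      by rewrite {1}(divn_eq (S m a) l) (S_l a lt_af) natrD natrM; ring.
    by rewrite big_split /= -mulr_suml -mulr_sumr th_sum mulr0 addr0.
  apply: Zadjoin_idealMl => //; apply: Zadjoin_sum => a _.
  by apply: ZadjoinM; [apply: Zadjoin_nat | apply: ZadjoinX].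
rewrite jacobi_sum_expansion; split=> [IJ | S_l]; last first.
  rewrite big_nat; apply: Zadjoin_ideal_sum => m /andP[m_gt0 _].
  have [le_km | lt_mk] := leqP k m; first exact: pXI.
  apply: Zadjoin_idealMl; first exact: ZadjoinX.
  by apply: uI; apply: S_l; rewrite m_gt0.
elim/ltn_ind => m IHm /andP[m_gt0 lt_mk].
have [le_Fm | lt_mF] := leqP #|F| m.
  suffices S0 a : S m a = 0%N by move=> a _; rewrite !S0.
  rewrite /S /jacobi_class_coef big1 // => x /andP[/andP[x0 x1] _].
  apply: bin_small; have := @ltn_dlog _ _ g_gen (1 - x); rewrite subr_eq0 eq_sym => /(_ x1).
  by move=> lt_xN; rewrite (leq_trans lt_xN) // (leq_trans (leq_pred _)).
have: in_Zadjoin_ideal zeta (p ^+ m.+1) (p ^+ m * u m).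
  have -> : p ^+ m * u m = \sum_(1 <= n < #|F|) p ^+ n * u n
      - (\sum_(1 <= n < m) p ^+ n * u n + \sum_(m.+1 <= n < #|F|) p ^+ n * u n).
    rewrite [in RHS](big_cat_nat m_gt0 (ltnW lt_mF)) /=.
    by rewrite [X in _ + X - _]big_ltn //; ring.
  apply: Zadjoin_idealD.
    apply: Zadjoin_ideal_trans IJ; exists (p ^+ (k - m.+1)); first exact: ZadjoinX.
    by rewrite -exprD subnKC.
  apply/Zadjoin_idealN/Zadjoin_idealD; rewrite big_nat.
    apply: Zadjoin_ideal_sum => n /andP[n_gt0 lt_nm].
    apply: Zadjoin_idealMl; first exact: ZadjoinX.
    apply: Zadjoin_ideal_trans (uI n _).
      by exists (p ^+ (k - m.+1)); [apply: ZadjoinX | rewrite -exprD subnKC].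
    by apply: IHm => //; rewrite n_gt0 (ltn_trans lt_nm).
  by apply: Zadjoin_ideal_sum => n /andP[lt_mn _]; apply: pXI.
move=> [y Zy Dy]; have {}Dy : u m = p * y.
  by apply: (mulfI (expf_neq0 m p_neq0)); rewrite Dy exprSr mulrA.
apply: (sum_prim_root_dvd l_pr f_pr l_neq_f om_prim th_prim _ Dy).
exact: Zadjoin_Aint Zy.
Qed.

End JacobiSumExpansion.

(** Both sides are carried to the quotient mod l, where they say U_m = 0 for 0 < m < k and V_i = 0
    for i + 2 <= k. *)
Lemma jacobi_class_coef_eta (l f : nat) (F : finFieldType) (g : {unit F}) (xil xif : F) k :
    prime l -> prime f -> l <> f -> generator [set: {unit F}] g -> (l * f %| #|F|.-1)%N ->
    xil ^+ l = 1 -> xil ^+ f = root_of_generator g (l * f) ^+ f ->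
    xif ^+ f = 1 -> xif ^+ l = root_of_generator g (l * f) ^+ l -> (k <= l - 1)%N ->
  (forall m, (0 < m < k)%N -> forall a, (a < f)%N ->
     jacobi_class_coef g f m a = jacobi_class_coef g f m 0 %[mod l]) <->
  (forall i j, (i + 2 <= k)%N -> (0 < j < f)%N -> unit_power l (eta_prod l xil xif i j)).
Proof.
move=> l_pr f_pr l_neq_f g_gen lf_dvd xil_root xil_f xif_root xif_l le_kl.
have [R [theta [charR sum0 indep]]] := prime_cyclotomic_quotient l_pr f_pr.
have f_gt0 := prime_gt0 f_pr.
have l_dvd : (l %| #|F|.-1)%N by apply: dvdn_trans lf_dvd; apply: dvdn_mulr.
have f_dvd : (f %| #|F|.-1)%N by apply: dvdn_trans lf_dvd; apply: dvdn_mull.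
have theta_f : theta ^+ f = 1.
  by apply/eqP; rewrite -subr_eq0 subrX1 -(big_mkord predT (fun i => theta ^+ i)) sum0 mulr0.
have theta_N : theta ^+ #|F|.-1 = 1 by rewrite -(divnK f_dvd) mulnC exprM theta_f expr1n.
have sumN : \sum_(0 <= n < #|F|.-1) theta ^+ n = 0.
  by rewrite -(divnK f_dvd) sum_exp_period.
pose P (x : F) := (x != 0) && (x != 1).
pose G i (y : F) := ('C(dlog g y, i) * dlog g (1 - y)%R)%N.
pose L i a := (\sum_(y | P y && (dlog g y %% f == a)) G i y)%N.
have LE i j : (i + 2 <= k)%N -> (0 < j < f)%N ->
    unit_power l (eta_prod l xil xif i j) <-> (L i j)%:R = 0 :> R.
  move=> le_ik /andP[j_gt0 lt_jf]; have fNj : ~~ (f %| j)%N by rewrite gtnNdvd.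
  have lt_il : (i < l)%N by clear -le_ik le_kl; lia.
  have eta0 := eta_prod_neq0 l_pr f_pr l_neq_f g_gen lf_dvd
    xil_root xif_root xil_f xif_l charR i fNj.
  rewrite (unit_powerP g_gen lf_dvd charR eta0).
  rewrite (natr_dlog_eta_prod_sum l_pr f_pr l_neq_f g_gen lf_dvd
    xil_root xif_root xil_f xif_l charR lt_il fNj).
  rewrite natr_sum; suff -> : \sum_(y | (y != 0) && (dlog g y == j %[mod f]))
      'C(dlog g y, i)%:R * (dlog g (1 - y))%:R
      = \sum_(y | P y && (dlog g y %% f == j)%N) (G i y)%:R :> R by [].
  apply: eq_big => [y | y _]; last by rewrite natrM.
  rewrite (modn_small lt_jf) /P; have [-> | y1] := eqVneq y 1; last by rewrite andbT.
  by rewrite (dlog1 g_gen) mod0n (ltn_eqF j_gt0) !andbF.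
have dlog_sum (H : F -> nat) := sum_dlog_class g P H f_gt0 theta_f.
transitivity (forall i, (i + 2 <= k)%N ->
    \sum_(y | P y) (theta ^+ dlog g y - 1) * 'C(dlog g y, i)%:R * (dlog g (1 - y))%:R = 0).
  rewrite -(jacobi_coef_vanish charR g_gen l_dvd theta_N sumN le_kl).
  split=> [S_l m lt_mk | U0 m lt_mk].
    rewrite (dlog_sum (fun x => 'C(dlog g (1 - x), m))).
    transitivity (\sum_(0 <= a < f) (jacobi_class_coef g f m 0)%:R * theta ^+ a).
      apply: eq_big_nat => a /andP[_ lt_af]; congr (_ * _).
      exact/(natr_eq_modn charR)/S_l.
    by rewrite -mulr_sumr sum0 mulr0.
  by apply: indep; rewrite -[RHS](U0 m lt_mk) (dlog_sum (fun x => 'C(dlog g (1 - x), m))).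
have VE i : \sum_(y | P y) (theta ^+ dlog g y - 1) * 'C(dlog g y, i)%:R * (dlog g (1 - y))%:R
    = \sum_(0 <= a < f) (L i a)%:R * theta ^+ a - \sum_(0 <= a < f) (L i a)%:R.
  transitivity (\sum_(y | P y) (theta ^+ dlog g y * (G i y)%:R - (G i y)%:R)).
    by apply: eq_bigr => y _; rewrite natrM; ring.
  rewrite sumrB dlog_sum; congr (_ - _).
  have := sum_dlog_class g P (G i) f_gt0 (expr1n R f).
  under eq_bigr => y _ do rewrite expr1n mul1r.
  by move=> ->; apply: eq_bigr => a _; rewrite expr1n mulr1.
split=> [V0 i j le_ik lt_jf | eta_l i le_ik]; last first.
  have L0 a : (0 < a < f)%N -> (L i a)%:R = 0 :> R by move=> lt_af; apply/LE/eta_l.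
  rewrite VE -sumrB big_nat big1 // => a /andP[_ lt_af].
  have [-> | a_gt0] := posnP a; first by rewrite expr0 mulr1 subrr.
  by rewrite L0 ?a_gt0 // mul0r subrr.
apply/LE => //; have /andP[j_gt0 lt_j] := lt_jf.
(* V_i = 0 is a relation between powers of theta with constant coefficient L_0 - SL; [s] realizes it
   in nat, with l - 1 standing for -1. *)
pose SL := (\sum_(0 <= a < f) L i a)%N.
pose s a := if a == 0%N then (L i 0%N + (l - 1) * SL)%N else L i a.
have l1 : (l - 1)%:R = -1 :> R.
  by rewrite natrB ?prime_gt0 // (pcharf0 charR) sub0r.
have s0 : (s 0%N)%:R = (L i 0%N)%:R - SL%:R :> R by rewrite /s eqxx natrD natrM l1 mulN1r.
have s_sum : \sum_(0 <= a < f) (s a)%:R * theta ^+ a = 0.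
  rewrite -[RHS](V0 i le_ik) VE -natr_sum -/SL (big_ltn f_gt0) [in RHS](big_ltn f_gt0).
  rewrite s0 expr0 !mulr1.
  rewrite [RHS]addrAC; congr (_ + _); apply: eq_big_nat => a /andP[a_gt0 _].
  by rewrite /s eqn0Ngt a_gt0.
have Ls a : (0 < a < f)%N -> (L i a)%:R = (L i 0%N)%:R - SL%:R :> R.
  move=> /andP[a_gt0 lt_af]; rewrite -s0 -(natr_eq_modn charR (indep s s_sum a lt_af)).
  by rewrite /s eqn0Ngt a_gt0.
have co_fl : coprime f l by rewrite prime_coprime // dvdn_prime2 //; apply/eqP/nesym.
(* All L_a with 0 < a < f equal L_0 - SL, while SL = L_0 + (f - 1) L_j; hence f L_j = 0. *)
apply: (coprime_natr_mulf_eq0 charR co_fl).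
have SLE : SL%:R = (L i 0%N)%:R + (f - 1)%:R * (L i j)%:R :> R.
  rewrite /SL natr_sum (big_ltn f_gt0); congr (_ + _).
  rewrite mulr_natl -sumr_const_nat; apply: eq_big_nat => a lt_af.
  by rewrite (Ls a lt_af) (Ls j lt_jf).
by move: (Ls j lt_jf); rewrite SLE natrB // => /eqP; rewrite -subr_eq0 => /eqP <-; ring.
Qed.

Theorem theorem8p2 (l f : nat) (l_prime : prime l) (f_prime : prime f)
    (l_neq_f : l <> f)
    (F : finFieldType) (q_mod : #|F| = 1 %[mod l * f])
    (g : {unit F}) (g_gen : generator [set: {unit F}] g)
    (zeta : algC) (zeta_prim : (l * f)%N.-primitive_root zeta)
    (chi : 'CF([set: {unit F}]))
    (chi_lin : chi \is a linear_char)
    (chi_L : forall u : {unit F}, Qadjoin zeta (chi u))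
    (chi_order : #[chi]%CF = (l * f)%N)
    (xil : F) (xil_root : xil ^+ l = 1)
    (xil_f : xil ^+ f = root_of_generator g (l * f) ^+ f)
    (xif : F) (xif_root : xif ^+ f = 1)
    (xif_l : xif ^+ l = root_of_generator g (l * f) ^+ l) :
  let J := jacobi_sum (chi ^+ l) (chi ^+ f) in
  let pil := zeta ^+ f - 1 in
  (forall k : nat, (1 <= k <= l - 1)%N ->
     [<-> in_Zadjoin_ideal zeta (pil ^+ k) (J + 1);
          forall i j : nat, (i + 2 <= k)%N -> (1 <= j <= f - 1)%N ->
            unit_power l (eta_prod l xil xif i j);
          forall i j : nat, (i + 2 <= k)%N -> (1 <= j)%N -> (2 * j <= f)%N ->
            unit_power l (eta_prod l xil xif i j)])
  /\ in_Zadjoin_ideal zeta pil (J + 1).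
Proof.
move=> J pil.
have l_gt1 := prime_gt1 l_prime; have f_gt1 := prime_gt1 f_prime.
have l_gt0 := prime_gt0 l_prime; have f_gt0 := prime_gt0 f_prime.
have lf_dvd : (l * f %| #|F|.-1)%N.
  have F_gt0 : (0 < #|F|)%N by rewrite (cardD1 0) inE.
  by rewrite -subn1 -eqn_mod_dvd //; apply/eqP.
have f_dvd : (f %| #|F|.-1)%N by apply: dvdn_trans lf_dvd; apply: dvdn_mull.
have c_prim : (l * f)%N.-primitive_root (chi g) by rewrite -chi_order; apply: prim_root_cforder.
have om_prim : l.-primitive_root (chi g ^+ f).
  by have := dvdn_prim_root c_prim (dvdn_mulr f (dvdnn l)); rewrite mulKn.
have th_prim : f.-primitive_root (chi g ^+ l).
  by have := dvdn_prim_root c_prim (dvdn_mull l (dvdnn f)); rewrite mulnK.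
(* zeta and chi(g) are powers of each other, so [pil] and chi(g)^f - 1 generate the same ideal. *)
have [c Dc] := prim_rootP zeta_prim (prim_expr_order c_prim).
have [c' Dc'] := prim_rootP c_prim (prim_expr_order zeta_prim).
have Zzeta : zeta \in Aint by apply: Aint_prim_root zeta_prim.
have Zc n : Zadjoin zeta (chi g ^+ n).
  by rewrite Dc; apply/ZadjoinX/ZadjoinX/Zadjoin_id.
have DJ : J = \sum_(x | (x != 0) && (x != 1))
    (chi g ^+ l) ^+ dlog g x * (chi g ^+ f) ^+ dlog g (1 - x).
  apply: eq_bigr => x /andP[x0 x1]; have x10 : 1 - x != 0 by rewrite subr_eq0 eq_sym.
  by rewrite !(cfun_at_dlog g_gen) ?rpredX // !exp_cfunE ?inE.
have idealE k : (k <= l - 1)%N -> in_Zadjoin_ideal zeta (pil ^+ k) (J + 1) <->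
    (forall i j, (i + 2 <= k)%N -> (0 < j < f)%N -> unit_power l (eta_prod l xil xif i j)).
  move=> le_kl; rewrite -(jacobi_class_coef_eta l_prime f_prime l_neq_f g_gen lf_dvd
    xil_root xil_f xif_root xif_l le_kl).
  rewrite -(jacobi_sum_ideal l_prime f_prime l_neq_f g_gen f_dvd Zzeta om_prim th_prim
    (Zc f) (Zc l) le_kl) -DJ.
  have pil_p : in_Zadjoin_ideal zeta (chi g ^+ f - 1) pil.
    by rewrite /pil {2}Dc' exprAC; apply/Zadjoin_ideal_exp_sub1/Zc.
  have p_pil : in_Zadjoin_ideal zeta pil (chi g ^+ f - 1).
    by rewrite Dc exprAC; apply/Zadjoin_ideal_exp_sub1/ZadjoinX/Zadjoin_id.
  by split; apply: Zadjoin_ideal_trans; apply: Zadjoin_idealX.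
have jE j : (1 <= j <= f - 1)%N = (0 < j < f)%N by clear -f_gt0; lia.
split=> [k /andP[k_gt0 le_kl] |]; last first.
  (* This is the case k = 1, where no i satisfies i + 2 <= k. *)
  rewrite -[pil]expr1; apply/idealE => [|i j]; first by rewrite subn_gt0.
  by rewrite addn2.
tfae=> [/(idealE k le_kl) eta_l i j le_ik lt_jf | eta_l i j le_ik j_gt0 le_jf | eta_l].
- by apply: eta_l; rewrite // -jE.
- by apply: eta_l => //; clear -j_gt0 le_jf f_gt1; lia.
apply/idealE => // i j le_ik lt_jf; have [le_jf | lt_f2j] := leqP (2 * j) f.
  by apply: eta_l => //; case/andP: lt_jf.
have charFl : l \in [pchar 'F_l] by apply: pchar_Fp.
have eta0 a b : (0 < b < f)%N -> eta_prod l xil xif a b != 0.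
  by move=> /andP[b_gt0 lt_bf]; apply: (eta_prod_neq0 l_prime f_prime l_neq_f g_gen lf_dvd
    xil_root xif_root xil_f xif_l charFl); rewrite gtnNdvd.
(* Here 2 j > f, so f - j lies in the lower half and the reflection transfers the result to j. *)
apply/(unit_powerP g_gen lf_dvd charFl); first exact: eta0.
have lt_fj : (0 < f - j < f)%N by clear -lt_jf; lia.
have -> : j = (f - (f - j))%N by clear -lt_jf; lia.
apply: (eta_prod_reflect l_prime f_prime l_neq_f g_gen lf_dvd
  xil_root xif_root xil_f xif_l charFl) => // [|a le_ai].
  by clear -le_ik le_kl; lia.
apply/(unit_powerP g_gen lf_dvd charFl); first exact: eta0.
by clear -eta_l le_ik le_ai lt_f2j lt_jf; apply: eta_l; lia.
Qed.
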